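(* For all letters $a\in[n]$, $$\mathrm{R2R}_{n+1}\circ\operatorname{sh}^n_a-\operatorname{sh}^n_a\circ\mathrm{R2R}_n=(n+1)\operatorname{sh}^n_a+\sum_{1\le b\le n}\operatorname{sh}^n_b\circ\Theta^n_{b,a}=\operatorname{sh}^n_a+\sum_{1\le b\le n}\Theta^{n+1}_{b,a}\circ\operatorname{sh}^n_b$$ as linear maps $M^{(n)}\to M^{(n+1)}$.
   Context: The alphabet is $[n]=\{1,\dots,n\}$; $M^{(m)}$ is the complex space with basis the words of length $m$ over it. For a letter $a$ and a word $w=w_1\cdots w_m$: $\operatorname{sh}^m_a(w)=\sum_{j=0}^m w_1\cdots w_j\,a\,w_{j+1}\cdots w_m\in M^{(m+1)}$; $\Theta^m_{p,q}(w)=\sum_{k:w_k=p}w_1\cdots w_{k-1}\,q\,w_{k+1}\cdots w_m\in M^{(m)}$; extended linearly. $\mathrm{R2R}_m:M^{(m)}\to M^{(m)}$ is the right action of $\xi_m=m\cdot\mathbf 1+\sum_{1\le u<v\le m}(u,u+1,\dots,v)+\sum_{1\le v<u\le m}(u,u-1,\dots,v)\in\mathbb C\mathfrak S_m$, where $\mathfrak S_m$ acts on words of length $m$ on the right by $w\cdot\sigma=w_{\sigma(1)}\cdots w_{\sigma(m)}$; equivalently, $\mathrm{R2R}_m(w)$ is the sum over all $m^2$ ways of removing a letter of $w$ and reinserting it in one of the $m$ positions. *)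

(* Defs.v *)
From HB Require Import structures.
From mathcomp Require Import all_boot all_order all_fingroup all_algebra.
From mathcomp Require Import reals complex.

Set Implicit Arguments.
Unset Strict Implicit.
Unset Printing Implicit Defensive.

Import Order.TTheory GRing.Theory Num.Theory.
Local Open Scope ring_scope.

(* [K^o] is [K] viewed as a module over itself. *)
Definition freemod (K : comNzRingType) (I : finType) : vectType K :=
  {ffun I -> K^o}.

Definition bvec (K : comNzRingType) (I : finType) (x : I) : freemod K I :=
  [ffun y => (y == x)%:R : K^o].

Definition linext (K : comNzRingType) (I J : finType) (f : I -> freemod K J) :
    'Hom(freemod K I, freemod K J) :=
  linfun (fun x : freemod K I => \sum_(i : I) ((x : {ffun I -> K^o}) i : K) *: f i).

(* [linfun] is only meaningful on linear functions; this is one. *)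
Lemma linextE (K : comNzRingType) (I J : finType) (f : I -> freemod K J)
    (x : freemod K I) :
  linext f x = \sum_(i : I) ((x : {ffun I -> K^o}) i : K) *: f i.
Proof.
pose g (y : freemod K I) : freemod K J :=
  \sum_(i : I) ((y : {ffun I -> K^o}) i : K) *: f i.
have lin_g : linear g.
  move=> c y z; rewrite /g scaler_sumr -big_split /=.
  by apply: eq_bigr => i _; rewrite !ffunE scalerDl scalerA.
pose gL := GRing.isLinear.Build K (freemod K I) (freemod K J) *:%R g lin_g.
pose G : {linear freemod K I -> freemod K J} := HB.pack g gL.
exact: (lfunE G x).
Qed.

Lemma linext_bvec (K : comNzRingType) (I J : finType) (f : I -> freemod K J)
    (i : I) : linext f (bvec K i) = f i.
Proof.
rewrite linextE (bigD1 i) //= ffunE eqxx scale1r big1 ?addr0 // => j /negPf ji.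
by rewrite ffunE ji scale0r.
Qed.

(* The cycle (s_1 s_2 ... s_k), mapping each s_i to s_(i+1) and s_k to s_1 and
   fixing everything else; [undup] only serves to make it total. *)
Definition cycle_perm (T : finType) (s : seq T) : {perm T} :=
  perm (can_inj (prev_next (undup_uniq s))).

Lemma cycle_permE (T : finType) (s : seq T) (x : T) :
  uniq s -> cycle_perm s x = next s x.
Proof. by move=> Us; rewrite permE undup_id. Qed.

(* [:: u; u + 1; ...; v] *)
Definition ord_range (m : nat) (u v : 'I_m) : seq 'I_m :=
  [seq i : 'I_m <- enum 'I_m | (u <= i <= v)%N].

(* Letters and positions are numbered from 0: ['I_n] stands for {1, ..., n}. *)
Notation word n m := (m.-tuple 'I_n).

Notation wordsp K n m := (freemod K (word n m)).

(* [w_1 ... w_j a w_(j+1) ... w_m] *)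
Lemma insert_letter_subproof (n m : nat) (a : 'I_n) (w : word n m) (j : 'I_m.+1) :
  size (take j w ++ a :: drop j w) == m.+1.
Proof. by rewrite size_cat /= addnS -size_cat cat_take_drop size_tuple. Qed.

Definition insert_letter (n m : nat) (a : 'I_n) (w : word n m) (j : 'I_m.+1) :
    word n m.+1 :=
  Tuple (insert_letter_subproof a w j).

Definition replace_letter (n m : nat) (w : word n m) (k : 'I_m) (q : 'I_n) :
    word n m :=
  [tuple if i == k then q else tnth w i | i < m].

Definition sh (K : comNzRingType) (n m : nat) (a : 'I_n) :
    'Hom(wordsp K n m, wordsp K n m.+1) :=
  linext (fun w : word n m => \sum_(j < m.+1) bvec K (insert_letter a w j)).

Definition Theta (K : comNzRingType) (n m : nat) (p q : 'I_n) :
    'End(wordsp K n m) :=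
  linext (fun w : word n m =>
    \sum_(k < m | tnth w k == p) bvec K (replace_letter w k q)).

(* w . s = w_(s 1) ... w_(s m).  This is a right action when permutations are
   composed as functions; MathComp's product in ['S_m] is the opposite one. *)
Definition word_act (n m : nat) (w : word n m) (s : 'S_m) : word n m :=
  [tuple tnth w (s i) | i < m].

(* The right action of the group algebra, whose underlying vector space is
   [freemod K 'S_m]. *)
Definition group_alg_act (K : comNzRingType) (n m : nat)
    (x : freemod K 'S_m) : 'End(wordsp K n m) :=
  linext (fun w : word n m =>
    \sum_(s : 'S_m) ((x : {ffun 'S_m -> K^o}) s : K) *: bvec K (word_act w s)).

Definition xi (K : comNzRingType) (m : nat) : freemod K 'S_m :=
  m%:R *: bvec K (1%g : 'S_m)
  + \sum_(u < m) \sum_(v < m | (u < v)%N) bvec K (cycle_perm (ord_range u v))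
  + \sum_(u < m) \sum_(v < m | (v < u)%N)
      bvec K (cycle_perm (rev (ord_range v u))).

Definition R2R (K : comNzRingType) (n m : nat) : 'End(wordsp K n m) :=
  group_alg_act n (xi K m).

Arguments sh K {n} m a.
Arguments Theta K {n} m p q.

(* Main.v *)
(* Write [b] for the letter at position [k] of [w] and [w'] for [w] without that
   position.  Since the permutations occurring in [xi] are those moving one
   position [k] to another and keeping the order of the rest, [R2R w] is the sum
   over [k] of [sh b w'].  Apply this to the words of [sh a w].  Removing the
   inserted [a] gives [sh a w] each time.  Removing [b] instead leaves the words
   of [sh a w'], except that the gap left by [b] is met twice, as [a] may stand on
   either side of [b]; the extra word is [w] with [b] replaced by [a].  As [sh b]
   and [sh a] commute, only the terms from removing [a] and the extra words
   survive in the commutator.  For the second equality, [Theta b a] replaces in a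
   word of [sh b w] either the inserted letter, which yields [sh a w] for each of
   the [n] letters [b], or a letter of [w]. *)
Require Import Defs.
From HB Require Import structures.
From mathcomp Require Import all_boot all_order all_fingroup all_algebra.
From mathcomp Require Import reals complex.
From mathcomp Require Import zify.

Set Implicit Arguments.
Unset Strict Implicit.
Unset Printing Implicit Defensive.

Import Order.TTheory GRing.Theory Num.Theory.
Local Open Scope ring_scope.

Lemma freemod_hom_eq (K : comNzRingType) (I J : finType)
    (f g : 'Hom(freemod K I, freemod K J)) :
  (forall i, f (bvec K i) = g (bvec K i)) -> f = g.
Proof.
move=> fg; apply/lfunP => x.
have -> : x = \sum_i ((x : {ffun I -> K^o}) i : K) *: bvec K i.
  apply/ffunP => j; rewrite sum_ffunE (bigD1 j) //= !ffunE eqxx big1 ?addr0.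
    by rewrite /GRing.scale /= mulr1.
  by move=> i /negPf ij; rewrite !ffunE eq_sym ij scaler0.
by rewrite !linear_sum; apply: eq_bigr => i _; rewrite !linearZ /= fg.
Qed.

(** * Cycles of consecutive positions and the element [xi] *)

Lemma next_iota (u k x : nat) :
  (u <= x < u + k.+1)%N ->
  next (iota u k.+1) x = if (x < u + k)%N then x.+1 else u.
Proof.
move=> xu; have x_in : x \in iota u k.+1 by rewrite mem_iota.
have idx : index x (iota u k.+1) = (x - u)%N.
  rewrite -[X in index X _](_ : nth 0%N (iota u k.+1) (x - u) = x).
    by rewrite index_uniq ?iota_uniq ?size_iota //; lia.
  by rewrite nth_iota; lia.
rewrite next_nth x_in idx -[iota u k.+1]/(u :: iota u.+1 k).
(* At the last entry the index runs past the tail, and the default of [nth] is the head [u]: the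
   cycle closes. *)
case: ltnP => xk; last by rewrite nth_default // size_iota; lia.
by rewrite nth_iota; lia.
Qed.

Lemma ord_range_uniq (m : nat) (u v : 'I_m) : uniq (ord_range u v).
Proof. exact: filter_uniq (enum_uniq _). Qed.

Lemma map_val_ord_range (m : nat) (u v : 'I_m) :
  (u <= v)%N -> map val (ord_range u v) = iota u (v - u).+1.
Proof.
move=> uv; have lt_vm := ltn_ord v.
rewrite /ord_range -[LHS](filter_map val (fun i : nat => (u <= i <= v)%N)).
rewrite val_enum_ord; apply: (@irr_sorted_eq _ ltn) => //.
- exact: ltn_trans.
- exact: ltnn.
- exact: (sorted_filter ltn_trans _ (iota_ltn_sorted _ _)).
- exact: iota_ltn_sorted.
by move=> x; rewrite mem_filter !mem_iota; lia.
Qed.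

(** Both permutations send [v] to [u] and are increasing on the remaining positions. *)
Lemma cycle_ord_range (m : nat) (u v : 'I_m.+1) :
  (u <= v)%N -> cycle_perm (ord_range u v) = lift_perm v u 1.
Proof.
move=> uv; have U := ord_range_uniq u v.
have E (x : 'I_m.+1) : val (cycle_perm (ord_range u v) x) =
    if (u <= x <= v)%N then if (x < v)%N then x.+1 else val u else val x.
  rewrite cycle_permE // -(next_map val_inj U) map_val_ord_range //.
  case: ifP => xuv; last first.
    by rewrite next_nth mem_iota; case: ifP => //= ?; exfalso; lia.
  by rewrite next_iota /= ?subnKC //; lia.
apply/permP => x; apply: val_inj; rewrite E.
case: (unliftP v x) => [i ->|->]; last by rewrite lift_perm_id uv leqnn ltnn.
rewrite lift_perm_lift perm1 /= /bump.
by case: (leqP v i); case: (leqP u i) => /= ? ?; repeat case: ifP; lia.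
Qed.

Lemma cycle_rev (T : finType) (s : seq T) :
  uniq s -> cycle_perm (rev s) = (cycle_perm s)^-1%g.
Proof.
move=> Us; apply/permP => x; apply: (@perm_inj _ (cycle_perm s)).
by rewrite permKV !cycle_permE ?rev_uniq // next_rev // next_prev.
Qed.

(** The copies of the identity are the diagonal terms; a descending cycle is the inverse of an
    ascending one, and inversion swaps the two indices of [lift_perm]. *)
Lemma xiE (K : comNzRingType) (m : nat) :
  xi K m.+1 = \sum_(u < m.+1) \sum_(v < m.+1) bvec K (lift_perm v u 1%g).
Proof.
rewrite /xi; have -> : m.+1%:R *: bvec K (1%g : 'S_m.+1)
    = \sum_(u < m.+1) bvec K (lift_perm u u 1%g).
  under eq_bigr do rewrite lift_perm1.
  by rewrite sumr_const card_ord scaler_nat.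
rewrite -!big_split; apply: eq_bigr => u _ /=.
rewrite [RHS](bigD1 u) //= -addrA; congr (_ + _).
rewrite [RHS](bigID (fun v : 'I_m.+1 => (u < v)%N)) /=; congr (_ + _).
  apply: eq_big => [v|v uv]; last by rewrite cycle_ord_range // ltnW.
  by rewrite -val_eqE /=; lia.
apply: eq_big => [v|v vu]; first by rewrite -val_eqE /=; lia.
rewrite cycle_rev ?ord_range_uniq // cycle_ord_range ?(ltnW vu) //.
by rewrite lift_permV invg1.
Qed.

(** * Inserting, deleting and replacing letters *)

Section Letters.
Variables (n m : nat).
Implicit Types (a b : 'I_n).

Definition delete_letter (w : word n m.+1) (k : 'I_m.+1) : word n m :=
  [tuple tnth w (lift k i) | i < m].

Lemma tnth_insert_id a (w : word n m) (j : 'I_m.+1) :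
  tnth (insert_letter a w j) j = a.
Proof.
rewrite (tnth_nth a) /= nth_cat size_take_min size_tuple.
have := ltn_ord j; rewrite ltnS => /minn_idPl ->.
by rewrite ltnn subnn.
Qed.

Lemma tnth_insert_lift a (w : word n m) (j : 'I_m.+1) (i : 'I_m) :
  tnth (insert_letter a w j) (lift j i) = tnth w i.
Proof.
have ltim := ltn_ord i; have ltjm := ltn_ord j.
rewrite !(tnth_nth a) /= nth_cat size_take_min size_tuple /bump.
case: (leqP j i) => ji /=.
  case: ltnP => ?; first by lia.
  have -> : (1 + i - minn j m = (i - j).+1)%N by lia.
  by rewrite /= nth_drop; congr nth; lia.
by case: ltnP => ?; [rewrite nth_take | lia].
Qed.

Lemma tnth_replace_id (w : word n m) (k : 'I_m) a :
  tnth (replace_letter w k a) k = a.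
Proof. by rewrite tnth_mktuple eqxx. Qed.

Lemma tnth_replace_neq (w : word n m) (k i : 'I_m) a :
  i != k -> tnth (replace_letter w k a) i = tnth w i.
Proof. by rewrite tnth_mktuple => /negPf ->. Qed.

End Letters.

Lemma eq_word_lift (n m : nat) (j : 'I_m.+1) (w1 w2 : word n m.+1) :
  tnth w1 j = tnth w2 j ->
  (forall i, tnth w1 (lift j i) = tnth w2 (lift j i)) -> w1 = w2.
Proof. by move=> E1 E2; apply: eq_from_tnth => t; case: (unliftP j t) => [i|] ->. Qed.

(** The permutation sends [j] to [k], so letter [k] of [w] is read at position [j]. *)
Lemma word_act_lift_perm (n m : nat) (w : word n m.+1) (j k : 'I_m.+1) :
  word_act w (lift_perm j k 1%g)
    = insert_letter (tnth w k) (delete_letter w k) j.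
Proof.
apply: (@eq_word_lift _ _ j) => [|i].
  by rewrite tnth_mktuple lift_perm_id tnth_insert_id.
by rewrite tnth_insert_lift !tnth_mktuple lift_perm_lift perm1.
Qed.

Lemma delete_insert_id (n m : nat) (a : 'I_n) (w : word n m) (j : 'I_m.+1) :
  delete_letter (insert_letter a w j) j = w.
Proof.
by apply: eq_from_tnth => i; rewrite tnth_mktuple tnth_insert_lift.
Qed.

(* The position [lift ord0 i], that is [i + 1], puts [a] just after the letter to
   be removed. *)
Lemma delete_insert_after (n m : nat) (a : 'I_n) (w : word n m.+1) (i : 'I_m.+1) :
  let j := lift ord0 i in
  delete_letter (insert_letter a w j) (lift j i) = replace_letter w i a.
Proof.
move=> j; apply: (@eq_word_lift _ _ i) => [|s].
  rewrite tnth_replace_id tnth_mktuple (_ : lift (lift j i) i = j).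
    exact: tnth_insert_id.
  by apply: val_inj; rewrite /= /bump /=; lia.
rewrite tnth_replace_neq 1?eq_sym ?neq_lift // tnth_mktuple.
rewrite (_ : lift (lift j i) (lift i s) = lift j (lift i s)) ?tnth_insert_lift //.
by apply: val_inj; rewrite /= /bump /=; lia.
Qed.

(** As [l] varies, [j] runs over all places for [a] except the one just after letter [i], and each
    place in the shortened word is met once. *)
Lemma delete_insert_lift (n m : nat) (a : 'I_n) (w : word n m.+1)
    (i l : 'I_m.+1) :
  let j := lift (lift ord0 i) l in
  delete_letter (insert_letter a w j) (lift j i)
    = insert_letter a (delete_letter w i) l.
Proof.
move=> j; apply: (@eq_word_lift _ _ l) => [|s].
  rewrite tnth_insert_id tnth_mktuple (_ : lift (lift j i) l = j).
    exact: tnth_insert_id.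
  by apply: val_inj; rewrite /= /bump /=; lia.
rewrite tnth_insert_lift !tnth_mktuple.
rewrite (_ : lift (lift j i) (lift l s) = lift j (lift i s)) ?tnth_insert_lift //.
by apply: val_inj; rewrite /= /bump /=; lia.
Qed.

Lemma replace_insert_id (n m : nat) (a b : 'I_n) (w : word n m) (j : 'I_m.+1) :
  replace_letter (insert_letter b w j) j a = insert_letter a w j.
Proof.
apply: (@eq_word_lift _ _ j) => [|i].
  by rewrite tnth_replace_id tnth_insert_id.
by rewrite tnth_replace_neq 1?eq_sym ?neq_lift // !tnth_insert_lift.
Qed.

Lemma replace_insert_lift (n m : nat) (a b : 'I_n) (w : word n m)
    (j : 'I_m.+1) (i : 'I_m) :
  replace_letter (insert_letter b w j) (lift j i) a
    = insert_letter b (replace_letter w i a) j.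
Proof.
apply: (@eq_word_lift _ _ j) => [|s].
  by rewrite tnth_replace_neq ?neq_lift // !tnth_insert_id.
rewrite tnth_insert_lift !tnth_mktuple tnth_insert_lift.
by rewrite (inj_eq lift_inj).
Qed.

(* Position [k], as seen from the word with position [lift k j] removed. *)
Definition swap_lift (m : nat) (k : 'I_m.+2) (j : 'I_m.+1) : 'I_m.+1 :=
  odflt j (unlift (lift k j) k).

Lemma lift_swap_lift (m : nat) (k : 'I_m.+2) (j : 'I_m.+1) :
  lift (lift k j) (swap_lift k j) = k.
Proof.
have jk : lift k j != k by rewrite eq_sym neq_lift.
by case: (unlift_some jk) => i Ek Eu; rewrite /swap_lift Eu /= -Ek.
Qed.

Lemma swap_liftK (m : nat) (k : 'I_m.+2) (j : 'I_m.+1) :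
  swap_lift (lift k j) (swap_lift k j) = j.
Proof. by rewrite [LHS]/swap_lift lift_swap_lift liftK. Qed.

Lemma lift_lift_swap (m : nat) (k : 'I_m.+2) (j : 'I_m.+1) (i : 'I_m) :
  lift k (lift j i) = lift (lift k j) (lift (swap_lift k j) i).
Proof.
have /(congr1 val) := lift_swap_lift k j.
by rewrite /= => E; apply: val_inj; move: E; rewrite /= /bump; lia.
Qed.

(** In the final word [b] stands at [k] and [a] at [lift k j]; [swap_lift k j] is the place of [b]
    before [a] is put in. *)
Lemma insert_insert (n m : nat) (a b : 'I_n) (w : word n m)
    (k : 'I_m.+2) (j : 'I_m.+1) :
  insert_letter b (insert_letter a w j) k
    = insert_letter a (insert_letter b w (swap_lift k j)) (lift k j).
Proof.
apply: (@eq_word_lift _ _ k) => [|s].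
  rewrite tnth_insert_id -[X in _ = tnth _ X](lift_swap_lift k j).
  by rewrite tnth_insert_lift tnth_insert_id.
rewrite tnth_insert_lift; case: (unliftP j s) => [i|] ->.
  by rewrite lift_lift_swap !tnth_insert_lift.
by rewrite !tnth_insert_id.
Qed.

(** * The operators on basis words and their commutation relations *)

Section Shuffles.
Variables (K : comNzRingType) (n : nat).
Implicit Types (m : nat) (a b : 'I_n).

Lemma sh_bvec m a (w : word n m) :
  sh K m a (bvec K w) = \sum_(j < m.+1) bvec K (insert_letter a w j).
Proof. exact: linext_bvec. Qed.

Lemma Theta_bvec m a b (w : word n m) :
  Theta K m b a (bvec K w)
    = \sum_(k < m | tnth w k == b) bvec K (replace_letter w k a).
Proof. exact: linext_bvec. Qed.

Lemma R2R_bvec m (w : word n m.+1) :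
  R2R K n m.+1 (bvec K w)
    = \sum_(k < m.+1) sh K m (tnth w k) (bvec K (delete_letter w k)).
Proof.
rewrite /R2R /group_alg_act linext_bvec.
(* For fixed [w] the action is linear in the group algebra element, so the expansion of [xi] applies
   termwise. *)
rewrite -(linextE (fun s => bvec K (word_act w s))) xiE linear_sum.
apply: eq_bigr => k _; rewrite linear_sum sh_bvec; apply: eq_bigr => j _.
by rewrite /= linext_bvec word_act_lift_perm.
Qed.

Lemma sh_comm m a b :
  (sh K m.+1 b \o sh K m a)%VF = (sh K m.+1 a \o sh K m b)%VF.
Proof.
have E c d (w : word n m) : (sh K m.+1 c \o sh K m d)%VF (bvec K w) =
    \sum_(p : 'I_m.+1 * 'I_m.+2)
      bvec K (insert_letter c (insert_letter d w p.1) p.2).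
  rewrite comp_lfunE sh_bvec linear_sum /=.
  under eq_bigr do rewrite sh_bvec.
  exact: pair_big.
apply: freemod_hom_eq => w; rewrite !E.
(* [h] turns the positions for one order of insertion into those for the other. *)
pose h (p : 'I_m.+1 * 'I_m.+2) := (swap_lift p.2 p.1, lift p.2 p.1).
have hK : involutive h.
  by case=> j k; rewrite /h /= swap_liftK lift_swap_lift.
rewrite [RHS](reindex_inj (inv_inj hK)) /=.
by apply: eq_bigr => -[j k] _ /=; rewrite insert_insert.
Qed.

Lemma sum_sh_Theta m a (w : word n m) :
  (\sum_(b < n) (sh K m b \o Theta K m b a)%VF) (bvec K w)
    = \sum_(i < m) sh K m (tnth w i) (bvec K (replace_letter w i a)).
Proof.
rewrite sum_lfunE.
under eq_bigr do rewrite comp_lfunE Theta_bvec linear_sum big_mkcond.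
rewrite exchange_big; apply: eq_bigr => i _ /=.
by rewrite -big_mkcond (big_pred1 (tnth w i)) // => b; rewrite eq_sym.
Qed.

Lemma R2R_sh m a :
  (R2R K n m.+2 \o sh K m.+1 a)%VF - (sh K m.+1 a \o R2R K n m.+1)%VF
    = m.+2%:R *: sh K m.+1 a
      + \sum_(b < n) (sh K m.+1 b \o Theta K m.+1 b a)%VF.
Proof.
apply: freemod_hom_eq => w.
rewrite add_lfunE opp_lfunE [RHS]add_lfunE scale_lfunE sum_sh_Theta.
apply/eqP; rewrite subr_eq; apply/eqP.
rewrite !comp_lfunE [in LHS]sh_bvec [in LHS]linear_sum R2R_bvec.
rewrite [in RHS]linear_sum /=.
under eq_bigr => j _.
  rewrite R2R_bvec (bigD1_ord j) //= tnth_insert_id delete_insert_id.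
  under eq_bigr do rewrite tnth_insert_lift.
  over.
rewrite big_split sumr_const card_ord -scaler_nat -addrA; congr (_ + _).
(* From here the removed letter [i] of [w] is fixed and the place of [a] varies. *)
rewrite exchange_big -big_split; apply: eq_bigr => i _ /=.
rewrite -[sh K _ a _]comp_lfunE -sh_comm comp_lfunE [sh K m a _]sh_bvec.
rewrite -linear_sum -linearD; congr (sh K _ _ _).
(* Splitting off the place just after letter [i] isolates the extra word. *)
rewrite (bigD1_ord (lift ord0 i)) //= delete_insert_after.
by under eq_bigr do rewrite delete_insert_lift.
Qed.

Lemma sum_Theta_sh m a :
  \sum_(b < n) (Theta K m.+1 b a \o sh K m b)%VF
    = n%:R *: sh K m a + \sum_(b < n) (sh K m b \o Theta K m b a)%VF.
Proof.
have E b : (Theta K m.+1 b a \o sh K m b)%VF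
    = sh K m a + (sh K m b \o Theta K m b a)%VF.
  apply: freemod_hom_eq => w.
  rewrite add_lfunE !comp_lfunE Theta_bvec !sh_bvec !linear_sum /=.
  under [X in _ = _ + X]eq_bigr do rewrite sh_bvec.
  rewrite exchange_big -big_split; apply: eq_bigr => j _ /=.
  rewrite Theta_bvec big_mkcond (bigD1_ord j) //= tnth_insert_id eqxx.
  rewrite replace_insert_id [in RHS]big_mkcond; congr (_ + _).
  by apply: eq_bigr => i _; rewrite tnth_insert_lift replace_insert_lift.
by under eq_bigr do rewrite E; rewrite big_split sumr_const card_ord scaler_nat.
Qed.

End Shuffles.

Theorem theorem38 (R : realType) (n : nat) (a : 'I_n) :
  (R2R R[i] n n.+1 \o sh R[i] n a)%VF - (sh R[i] n a \o R2R R[i] n n)%VF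
    = n.+1%:R *: sh R[i] n a
      + \sum_(b < n) (sh R[i] n b \o Theta R[i] n b a)%VF
  /\
  n.+1%:R *: sh R[i] n a + \sum_(b < n) (sh R[i] n b \o Theta R[i] n b a)%VF
    = sh R[i] n a + \sum_(b < n) (Theta R[i] n.+1 b a \o sh R[i] n b)%VF.
Proof.
(* For [n = 0] there is no letter [a]. *)
split; first by case: n a => [[]//|m] a; exact: R2R_sh.
(* The coefficient [n.+1] counts insertion places in the first equality, but letters plus one here;
   they agree because the word length equals the alphabet size. *)
by rewrite sum_Theta_sh addrA mulrS scalerDl scale1r.
Qed.
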